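(* Let $a_0,b_0,c_0,d_0$ be constants and define sequences recursively by \begin{align*} a_{n+1}&=\frac{a_{n}^2 -a_n c_n - a_n d_n}{a_n-c_n}, & b_{n+1}&=b_{n},\\ c_{n+1}&=\frac {a_nc_n-2a_nd_n-c_n^{2}}{a_n-c_n}, & d_{n+1}&=\frac {a_nd_n}{a_n-c_n}, \end{align*} and set $\hat a_k=a_k-c_k$. Let $n>0$ and suppose $\hat a_k\neq0$ and $a_k\neq0$ for all $k\le n$. Then \begin{align*} a_{n+1}(c_0 - 2a_0 + a_n) &= a_0(c_0+d_0 -a_0),\\ \hat{a}_{n+1} &=- a_{n+1}+ 2a_0 - c_0 . \end{align*} *)

(* Defs.v *)
From HB Require Import structures.
From mathcomp Require Import all_boot all_order all_algebra.
Set Implicit Arguments.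
Unset Strict Implicit.
Unset Printing Implicit Defensive.
Import GRing.Theory.
Local Open Scope ring_scope.

Record coeffs (K : fieldType) : Type :=
  Coeffs { ca : K; cb : K; cc : K; cd : K }.

Definition ca_hat (K : fieldType) (s : coeffs K) : K := ca s - cc s.

(* In MathComp [x / 0 = 0], so [step] is total; it is meaningful only when
   [ca_hat s != 0]. *)
Definition step (K : fieldType) (s : coeffs K) : coeffs K :=
  let: Coeffs a b c d := s in
  Coeffs ((a ^+ 2 - a * c - a * d) / (a - c))
         b
         ((a * c - 2%:R * a * d - c ^+ 2) / (a - c))
         (a * d / (a - c)).

Fixpoint coeffs_seq (K : fieldType) (s0 : coeffs K) (n : nat) : coeffs K :=
  if n is m.+1 then step (coeffs_seq s0 m) else s0.

(* Main.v *)
(** Both [2a - c] and [a(c + d - a)] are conserved by the recursion.  Since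
    [a - c = (2a - c) - a] and [a_{n+1} + d_{n+1} = a_n], evaluating these two
    invariants at step [n+1] gives the two identities. *)
Require Import Defs.
From HB Require Import structures.
From mathcomp Require Import all_boot all_order all_algebra.
From mathcomp Require Import ring.
Set Implicit Arguments.
Unset Strict Implicit.
Unset Printing Implicit Defensive.
Import GRing.Theory.
Local Open Scope ring_scope.

Definition linear_inv (K : fieldType) (s : coeffs K) : K := 2%:R * ca s - cc s.

Definition quadratic_inv (K : fieldType) (s : coeffs K) : K :=
  ca s * (cc s + cd s - ca s).

(** The numerators of the new [a] and [d] add up to [a * (a - c)]. *)
Lemma ca_cd_step (K : fieldType) (s : coeffs K) :
  ca_hat s != 0 -> ca (step s) + cd (step s) = ca s.
Proof. by case: s => a b c d; rewrite /ca_hat /= => hat_neq0; field. Qed.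

(** The [d] terms cancel, and the numerator left factors as [(2a - c)(a - c)]. *)
Lemma linear_inv_step (K : fieldType) (s : coeffs K) :
  ca_hat s != 0 -> linear_inv (step s) = linear_inv s.
Proof.
by case: s => a b c d; rewrite /ca_hat /linear_inv /= => hat_neq0; field.
Qed.

(** The new [c + d - a] collapses to [-(a - c)], which cancels the denominator of the new [a]. *)
Lemma quadratic_inv_step (K : fieldType) (s : coeffs K) :
  ca_hat s != 0 -> quadratic_inv (step s) = quadratic_inv s.
Proof.
by case: s => a b c d; rewrite /ca_hat /quadratic_inv /= => hat_neq0; field.
Qed.

(** The bound on [k] is strict because reaching index [n] divides only by the [ca_hat] of earlier
    terms. *)
Lemma coeffs_seq_inv (K : fieldType) (T : Type) (f : coeffs K -> T)
    (s0 : coeffs K) (n : nat) :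
  (forall s, ca_hat s != 0 -> f (step s) = f s) ->
  (forall k, (k < n)%N -> ca_hat (coeffs_seq s0 k) != 0) ->
  f (coeffs_seq s0 n) = f s0.
Proof.
move=> f_step; elim: n => [//|n IHn] hat_neq0 /=.
rewrite f_step; last exact: hat_neq0.
by apply: IHn => k lt_kn; apply: hat_neq0; apply: ltnW.
Qed.

Theorem theorem6 (K : fieldType) (a0 b0 c0 d0 : K) (n : nat) :
  let s := coeffs_seq (Coeffs a0 b0 c0 d0) in
  let a := fun k => ca (s k) in
  let a_hat := fun k => ca_hat (s k) in
  (0 < n)%N ->
  (forall k : nat, (k <= n)%N -> a_hat k != 0 /\ a k != 0) ->
  a n.+1 * (c0 - 2%:R * a0 + a n) = a0 * (c0 + d0 - a0) /\
  a_hat n.+1 = - a n.+1 + 2%:R * a0 - c0.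
Proof.
move=> s a a_hat _ neq0.
(* [k < n.+1] is by definition [k <= n], so the invariants reach index [n.+1]. *)
have hat_neq0 k : (k < n.+1)%N -> ca_hat (s k) != 0 by move/neq0 => [].
have linE : linear_inv (s n.+1) = 2%:R * a0 - c0.
  by rewrite (coeffs_seq_inv (@linear_inv_step K) hat_neq0).
have quadE : quadratic_inv (s n.+1) = a0 * (c0 + d0 - a0).
  by rewrite (coeffs_seq_inv (@quadratic_inv_step K) hat_neq0).
have aE : ca (s n.+1) + cd (s n.+1) = a n by apply/ca_cd_step/hat_neq0.
split.
  (* With [a, c, d] taken at [n.+1], the bracket becomes [-(2a - c) + (a + d) = c + d - a]. *)
  by rewrite -quadE -aE -opprB -linE /quadratic_inv /linear_inv /a; ring.
by rewrite -addrA -linE /linear_inv /a_hat /ca_hat /a; ring.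
Qed.
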